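(* Let $f:\{0,1,\dots,N-1\}\to\{0,1\}$, $t=|f^{-1}(1)|$, and $0<\varepsilon\le1$. The algorithm $\mathbf{Approx\_Count}(f,\varepsilon)$ outputs an integer $\tilde t$ with $|\tilde t-t|\le\varepsilon t$ with probability at least $2/3$, using an expected number of evaluations of $f$ in $\Theta\big(\frac1\varepsilon\sqrt{N/t}\big)$ when $t>0$. If $t=0$, it outputs $\tilde t=0$ with certainty and uses a number of evaluations of $f$ in $\Theta(\sqrt N)$.
   Context: For $M\ge1$, $\mathbf F_M|x\rangle=\frac{1}{\sqrt M}\sum_{y=0}^{M-1}e^{2\pi ixy/M}|y\rangle$. For a unitary $\mathbf U$, $\Lambda_M(\mathbf U)$ is $|j\rangle|y\rangle\mapsto|j\rangle(\mathbf U^j|y\rangle)$, $0\le j<M$. With $\mathcal A=\mathbf F_N$ on basis $|0\rangle,\dots,|N-1\rangle$, $\mathbf S_f|x\rangle=(-1)^{f(x)}|x\rangle$, $\mathbf S_0$ negating $|0\rangle$ and fixing other basis states, and $\mathbf Q=-\mathcal A\mathbf S_0\mathcal A^{-1}\mathbf S_f$: $\mathbf{Count}(f,M)$ prepares $|0\rangle\otimes\mathcal A|0\rangle$ (first register $M$-dimensional), applies $\mathbf F_M$ to the first register, then $\Lambda_M(\mathbf Q)$, then $\mathbf F_M^{-1}$ to the first register, measures the first register obtaining $y$, and outputs $N\sin^2(\pi y/M)$; a call $\mathbf{Count}(f,M)$ is counted as $M$ evaluations of $f$. Algorithm $\mathbf{Approx\_Count}(f,\varepsilon)$: (1) set $\ell=0$;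 (2) increase $\ell$ by 1; (3) set $t'=\mathbf{Count}(f,2^\ell)$; (4) if $t'=0$ and $2^\ell<2\sqrt N$, go to step (2); (5) set $M=\lceil\frac{20\pi^2}{\varepsilon}2^\ell\rceil$; (6) set $t'=\mathbf{Count}(f,M)$; (7) output an integer $\tilde t$ with $|\tilde t-t'|\le 2/3$.
   Formalization: When t=0, the constants in Θ(√N) may depend on ε: the algorithm's last call to Count costs about √N/ε evaluations, so no upper constant uniform in ε exists (take N=1, f=0, ε→0). *)

(* Defs.v *)
From mathcomp Require Import all_boot all_order all_algebra.
From mathcomp Require Import reals trigo.
From mathcomp Require Export complex.

Set Implicit Arguments.
Unset Strict Implicit.
Unset Printing Implicit Defensive.

Import Order.TTheory GRing.Theory Num.Theory.
Local Open Scope ring_scope.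

Section QuantumCounting.
Variable R : realType.
Local Notation C := R[i].

Definition rC (x : R) : C := Complex x 0.
Definition expi (th : R) : C := Complex (cos th) (sin th).
Definition sqmod (z : C) : R := (complex.Re z) ^+ 2 + (complex.Im z) ^+ 2.

Definition QFT (M : nat) : 'M[C]_M :=
  \matrix_(y < M, x < M)
     (expi (2 * pi * (x * y)%:R / M%:R) / rC (Num.sqrt M%:R)).

Definition ket0 (N : nat) : 'cV[C]_N := \col_(x < N) (if (x : nat) == 0%N then 1 else 0).

Section WithOracle.
Variables (N : nat) (f : 'I_N -> bool).

Definition Aop : 'M[C]_N := QFT N.
Definition Sf : 'M[C]_N := \matrix_(i < N, j < N) (if i == j then (-1) ^+ f i else 0).
Definition S0 : 'M[C]_N :=
  \matrix_(i < N, j < N) (if i == j then (if (i : nat) == 0%N then -1 else 1) else 0).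
Definition Qop : 'M[C]_N := - (Aop *m S0 *m invmx Aop *m Sf).

(* A state of the two registers C^M (x) C^N is stored as an M x N matrix Psi,
   Psi j x = amplitude of |j>|x>. *)

Definition LambdaQ (M : nat) (Psi : 'M[C]_(M, N)) : 'M[C]_(M, N) :=
  \matrix_(j < M, x < N)
     (iter j (fun v : 'cV[C]_N => Qop *m v) (trmx (row j Psi))) x ord0.

Definition init_state (M : nat) : 'M[C]_(M, N) :=
  \matrix_(j < M, x < N) (if (j : nat) == 0%N then (Aop *m ket0 N) x ord0 else 0).

Definition count_final_state (M : nat) : 'M[C]_(M, N) :=
  invmx (QFT M) *m LambdaQ (QFT M *m init_state M).

Definition count_prob (M : nat) (y : 'I_M) : R :=
  \sum_(x < N) sqmod (count_final_state M y x).

Definition count_out (M : nat) (y : nat) : R :=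
  N%:R * (sin (pi * y%:R / M%:R)) ^+ 2.

(* Semantics of Approx_Count(f, eps) as an expectation functional:
   approx_count_expect eps rnd G = E[ G(output, number of evaluations of f) ].
   rnd models the choice in step (7) of an integer within 2/3 of t'.
   Each call Count(f, M) contributes M evaluations. *)
Variables (eps : R) (rnd : R -> int).

Definition final_phase (l acc : nat) (G : int -> nat -> R) : R :=
  let M := `|Num.ceil (20 * pi ^+ 2 / eps * (2 ^ l)%:R)|%N in
  \sum_(y < M) count_prob y * G (rnd (count_out M y)) (acc + M)%N.

(* steps (3)-(4) at loop counter l; fuel only ensures structural recursion:
   the loop stops once 2^l >= 2 sqrt N, long before the fuel N.+2 runs out *)
Fixpoint loop_phase (fuel l acc : nat) (G : int -> nat -> R) : R :=
  match fuel with
  | 0%N => 0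
  | fuel'.+1 =>
    let m := (2 ^ l)%N in
    \sum_(y < m) count_prob y *
       (if (count_out m y == 0) && ((m%:R : R) < 2 * Num.sqrt N%:R)
        then loop_phase fuel' l.+1 (acc + m)%N G
        else final_phase l (acc + m)%N G)
  end.

(* steps (1)-(2): l = 0, then l = 1 *)
Definition approx_count_expect (G : int -> nat -> R) : R :=
  loop_phase N.+2 1 0 G.

End WithOracle.

Definition nsol (N : nat) (f : 'I_N -> bool) : nat := #|[set x | f x]|.

Definition rounding (rnd : R -> int) : Prop :=
  forall x : R, `|(rnd x)%:~R - x| <= 2 / 3.

Definition success_prob (N : nat) (f : 'I_N -> bool) (eps : R) (rnd : R -> int) : R :=
  approx_count_expect f eps rnd
    (fun o _ => if `|o%:~R - (nsol f)%:R| <= eps * (nsol f)%:R then 1 else 0).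

Definition expected_evals (N : nat) (f : 'I_N -> bool) (eps : R) (rnd : R -> int) : R :=
  approx_count_expect f eps rnd (fun _ c => c%:R).

End QuantumCounting.

(* Main.v *)
Require Import Defs.
From mathcomp Require Import all_boot all_order all_algebra.
From mathcomp Require Import reals trigo.
From mathcomp Require Import ring lra zify.
From mathcomp Require Import functions topology normedtype derive.
Import Order.TTheory GRing.Theory Num.Theory.
Import numFieldNormedType.Exports.
Local Open Scope ring_scope.

(** Write K_M(p) = |1/M sum_(j < M) e^(i j p)|^2 and sin^2 th = t/N. Grover's
operator acts on the uniform state as a rotation by 2 th, so the law of the
estimate returned by Count(f, M) is that of N sin^2(pi y / M) when y has mass
K_M(2 th - 2 pi y / M).

Centring the phases gives K_M(p) >= (1 - (M p)^2 / 24)^2. While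
2^l th <= 1/5, it makes the loop continue with total probability at least
221/225; when 2^l th > 1/5, the final call gives the two grid points next to
M th / pi, both within eps t / 3 of t, mass at least 68/100; and
221/225 * 68/100 > 2/3. Rounding is harmless: either eps t >= 1, and
2/3 + eps t / 3 <= eps t, or the output is within less than 1 of t.

Conversely K_M(2 th) <= 1 / (M sin th)^2, so beyond 2^l sin th >= 2 each round
continues with probability at most 1/4 while costs only double, which bounds
the expected cost by O(1 / (eps sin th)). For t = 0 the kernel is a point mass
at y = 0 and everything is deterministic. *)

Set Implicit Arguments.
Unset Strict Implicit.
Unset Printing Implicit Defensive.

(** * Elementary bounds on sine, cosine and pi *)

Section TrigonometricBounds.
Variable R : realType.
Implicit Types x y : R.

Lemma ge0_of_derive_ge0 (f df : R -> R) x :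
  (forall y : R, is_derive y (1 : R) f (df y)) -> (forall y, 0 <= y -> 0 <= df y) ->
  f 0 = 0 -> 0 <= x -> 0 <= f x.
Proof.
move=> fdf df_ge0 f0 x0.
have [|c] := @MVT_segment R f df 0 x x0.
- apply: continuous_subspaceT => y; apply: differentiable_continuous.
  by apply/derivable1_diffP; have [] := fdf y.
- by rewrite in_itv /= => /andP[c0 _]; rewrite f0 !subr0 => ->; rewrite mulr_ge0 // df_ge0.
Qed.

Lemma sin_le_id x : 0 <= x -> sin x <= x.
Proof.
move=> x0; rewrite -subr_ge0.
apply: (@ge0_of_derive_ge0 (fun x => x - sin x) (fun x => 1 - cos x)) => //.
- by move=> y _; rewrite subr_ge0 cos_le1.
- by rewrite sin0 subrr.
Qed.

Lemma norm_sin_le_id x : `|sin x| <= `|x|.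
Proof.
wlog x0 : x / 0 <= x.
  move=> H; have [/H//|x0] := leP 0 x.
  by rewrite -normrN -sinN -[leRHS]normrN; apply: H; rewrite oppr_ge0 ltW.
rewrite (ger0_norm x0) ler_norml sin_le_id // andbT.
rewrite -subr_ge0 opprK.
apply: (@ge0_of_derive_ge0 (fun x => sin x + x) (fun x => cos x + 1)) => //.
- by move=> y _; rewrite -lerBlDr sub0r cos_geN1.
- by rewrite sin0 addr0.
Qed.

Lemma cos_ge_quadratic x : 1 - x ^+ 2 / 2 <= cos x.
Proof.
have -> : cos x = 1 - 2 * sin (x / 2) ^+ 2.
  have {1}-> : x = (x / 2) *+ 2 by rewrite mulr2n; lra.
  by rewrite cos_mulr2n cos2sin2; ring.
have : sin (x / 2) ^+ 2 <= (x / 2) ^+ 2.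
  rewrite -real_normK ?num_real // -[leRHS]real_normK ?num_real //.
  by rewrite lerXn2r ?nnegrE // norm_sin_le_id.
by lra.
Qed.

Lemma sin_ge_cubic x : 0 <= x -> x - x ^+ 3 / 6 <= sin x.
Proof.
move=> x0; rewrite -subr_ge0.
have -> : sin x - (x - x ^+ 3 / 6) = sin x - (x - 6^-1 * (x * (x * x))) by field.
apply: (@ge0_of_derive_ge0 (fun x => sin x - (x - 6^-1 * (x * (x * x))))
  (fun x => cos x - (1 - x ^+ 2 / 2))) => //.
- move=> y.
  have : is_derive y (1 : R) ((sin : R -> R) - (id - 6^-1 \*: (id * (id * id) : R -> R)))
      (cos y - (1 - y ^+ 2 / 2)).
    apply: is_derive_eq; rewrite /GRing.scale /= -[(id * id) y]/(y * y).
    by field.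
  by [].
- by move=> y _; rewrite subr_ge0 cos_ge_quadratic.
- by rewrite sin0; ring.
Qed.

(** Since [sin (pi / 3) = cos (pi / 6)], the double-angle formula lets the positive factor
    [cos (pi / 6)] cancel. *)
Lemma sin_pi6 : sin (pi / 6) = 1 / 2 :> R.
Proof.
have c0 : 0 < cos (pi / 6 : R).
  by apply: cos_gt0_pihalf; have := @pi_gt0 R; lra.
have : sin ((pi / 6) *+ 2) = cos (pi / 6) :> R.
  by rewrite -(cosBpihalf ((pi / 6) *+ 2)) -cosN; congr cos; rewrite mulr2n; lra.
rewrite sin_mulr2n -mulrnAr -[RHS]mulr1 => /(mulfI (lt0r_neq0 c0)).
by rewrite mulr2n; lra.
Qed.

Lemma pi_ge3 : 3 <= pi :> R.
Proof.
have : sin (pi / 6) <= pi / 6 :> R by apply: sin_le_id; have := @pi_gt0 R; lra.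
by rewrite sin_pi6; lra.
Qed.

Lemma pi_le315 : pi <= 315 / 100 :> R.
Proof.
have p0 := @pi_gt0 R.
have := @sin_ge_cubic (pi / 6).
rewrite sin_pi6 => H; have {}H := H ltac:(lra).
have p4 : pi <= 4 :> R by have := @pihalf_lt2 R; lra.
rewrite leNgt; apply/negP => lt_pi; set x := pi / 6 in H.
(* The product is g(x) - g(525/1000) for g(x) = x - x^3/6, where 525/1000 is one sixth of 3.15. As
   g(525/1000) > 1/2, this contradicts the cubic bound at pi/6; the crude bound [p4] keeps the
   second factor positive. *)
have : 0 < (x - 525/1000) * (1 - (x ^+ 2 + 525/1000 * x + (525/1000) ^+ 2) / 6).
  by apply: mulr_gt0; rewrite /x; nra.
by nra.
Qed.

Lemma sin_dist x y : `|sin x - sin y| <= `|x - y|.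
Proof.
have -> : sin x - sin y = 2 * sin ((x - y) / 2) * cos ((x + y) / 2).
  have {1}-> : x = (x + y) / 2 + (x - y) / 2 by lra.
  have {3}-> : y = (x + y) / 2 - (x - y) / 2 by lra.
  by rewrite sinD sinB; ring.
rewrite !normrM (ger0_norm (ler0n _ 2)).
have := norm_sin_le_id ((x - y) / 2); rewrite normrM normfV (ger0_norm (ler0n _ 2)).
have := cos_max ((x + y) / 2).
have := normr_ge0 (sin ((x - y) / 2)).
by have := normr_ge0 (cos ((x + y) / 2)); nra.
Qed.

(* On [0, pi/2] the cubic bound gives the factor 1 - pi^2/24 > 0.58. *)
Lemma sin_ge_linear x : 0 <= x <= pi / 2 -> 58 / 100 * x <= sin x.
Proof.
move=> /andP[x0 xp]; apply: le_trans (sin_ge_cubic x0).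
have : x ^+ 2 <= (315 / 200) ^+ 2 by have := pi_le315; nra.
move=> h; have : 0 <= x * (1 - x ^+ 2 / 6 - 58 / 100) by apply: mulr_ge0; lra.
by lra.
Qed.

End TrigonometricBounds.

(** * The Fejer kernel: closed forms, upper and lower bounds, total mass on a grid *)

Section FejerKernel.
Variable R : realType.
Implicit Types (M : nat) (p q a : R).

Definition fejer M p : R :=
  ((\sum_(j < M) cos (j%:R * p)) ^+ 2 + (\sum_(j < M) sin (j%:R * p)) ^+ 2) / M%:R ^+ 2.

Lemma fejer_ge0 M p : 0 <= fejer M p.
Proof. by rewrite divr_ge0 ?addr_ge0 ?sqr_ge0. Qed.

(** Multiplying the geometric sum by the unit e^(i q) preserves its modulus. A suitable [q] centres
    the phases or aligns them with the amplitudes of Grover iterates. *)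
Lemma fejer_phase q M p : fejer M p =
  ((\sum_(j < M) cos (j%:R * p + q)) ^+ 2 + (\sum_(j < M) sin (j%:R * p + q)) ^+ 2) / M%:R ^+ 2.
Proof.
rewrite /fejer; congr (_ / _).
under [in RHS]eq_bigr do rewrite cosD.
under [X in _ = _ + X ^+ 2]eq_bigr do rewrite sinD.
rewrite sumrB big_split /= -!mulr_suml.
by have := cos2Dsin2 q; nra.
Qed.

Lemma fejerN M p : fejer M (- p) = fejer M p.
Proof.
rewrite /fejer; under eq_bigr do rewrite mulrN cosN.
under [X in _ + X ^+ 2]eq_bigr do rewrite mulrN sinN.
by rewrite sumrN sqrrN.
Qed.

Lemma fejerD2pi M p : fejer M (p + pi *+ 2) = fejer M p.
Proof.
have e (j : 'I_M) : j%:R * (p + pi *+ 2) = j%:R * p + pi *+ 2 *+ j.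
  by rewrite mulrDr !mulr_natl.
have ec (j : 'I_M) : true -> cos (j%:R * (p + pi *+ 2)) = cos (j%:R * p).
  by rewrite e (periodicn (@cosD2pi R)).
have es (j : 'I_M) : true -> sin (j%:R * (p + pi *+ 2)) = sin (j%:R * p).
  by rewrite e (periodicn (@sinD2pi R)).
by rewrite /fejer (eq_bigr _ ec) (eq_bigr _ es).
Qed.

Lemma fejer0 M : (0 < M)%N -> fejer M 0 = 1.
Proof.
move=> M0; rewrite /fejer; under eq_bigr do rewrite mulr0 cos0.
rewrite [X in _ + X ^+ 2]big1 => [|j _]; last by rewrite mulr0 sin0.
rewrite sumr_const card_ord expr0n addr0 divff //.
by rewrite expf_neq0 // pnatr_eq0 -lt0n.
Qed.

(** The product-to-sum formula turns each term into a difference of consecutive sines, and the sum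
    telescopes. *)
Lemma dirichlet_cos M p q :
  2 * sin (p / 2) * (\sum_(j < M) cos (j%:R * p + q)) =
  sin (M%:R * p + q - p / 2) - sin (q - p / 2).
Proof.
elim: M => [|M IH]; first by rewrite big_ord0 mul0r add0r; ring.
rewrite big_ord_recr mulrDr IH /=.
have -> : M.+1%:R * p + q - p / 2 = (M%:R * p + q) + p / 2 by rewrite -natr1; lra.
by rewrite (sinB (_ + _)) (sinD (_ + _)); ring.
Qed.

Lemma dirichlet_sin M p q :
  2 * sin (p / 2) * (\sum_(j < M) sin (j%:R * p + q)) =
  cos (q - p / 2) - cos (M%:R * p + q - p / 2).
Proof.
under eq_bigr do rewrite -cosBpihalf -addrA.
rewrite dirichlet_cos.
have -> : M%:R * p + (q - pi / 2) - p / 2 = M%:R * p + q - p / 2 - pi / 2 by ring.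
have -> : q - pi / 2 - p / 2 = q - p / 2 - pi / 2 by ring.
by rewrite !sinBpihalf; ring.
Qed.

Lemma fejer_upper M p : (sin (p / 2) * M%:R) ^+ 2 * fejer M p <= 1.
Proof.
have [->|M0] := eqVneq (M%:R : R) 0; first by rewrite mulr0 expr0n mul0r.
(* With this phase the closed forms become sin(M p) and 1 - cos(M p), whose squares add up to 2 - 2
   cos(M p) <= 4. *)
set q := p / 2; rewrite (fejer_phase q) /q.
have := dirichlet_cos M p (p / 2); have := dirichlet_sin M p (p / 2).
rewrite subrr cos0 sin0 subr0 addrK.
set S := \sum_(j < M) _; set C := \sum_(j < M) _ => hS hC.
have -> : (sin (p / 2) * M%:R) ^+ 2 * ((C ^+ 2 + S ^+ 2) / M%:R ^+ 2) =
   ((2 * sin (p / 2) * C) ^+ 2 + (2 * sin (p / 2) * S) ^+ 2) / 4 by field.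
rewrite hS hC.
by have := cos2Dsin2 (M%:R * p); have := cos_geN1 (M%:R * p); nra.
Qed.

Lemma sum_centered_sqr M :
  \sum_(j < M) (j%:R - (M%:R - 1) / 2) ^+ 2 = M%:R * (M%:R ^+ 2 - 1) / 12 :> R.
Proof.
(* The centre is generalised because (M - 1)/2 would move during the induction on [M]. *)
have H b : \sum_(j < M) (j%:R - b) ^+ 2 =
    M%:R * (M%:R - 1) * (2 * M%:R - 1) / 6 - b * M%:R * (M%:R - 1) + M%:R * b ^+ 2 :> R.
  elim: M => [|M IH]; first by rewrite big_ord0; ring.
  by rewrite big_ord_recr /= IH -natr1; field.
by rewrite H; field.
Qed.

(** With phases symmetric about 0 the cosine sum alone suffices: the quadratic bound on each term
    and the second moment of the centred indices cost at most M (M p)^2 / 24. The bound 24 keeps the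
    base nonnegative, so that squaring is monotone. *)
Lemma fejer_lower M p : (0 < M)%N -> (M%:R * p) ^+ 2 <= 24 ->
  (1 - (M%:R * p) ^+ 2 / 24) ^+ 2 <= fejer M p.
Proof.
move=> M0 Mp; have M0' : 0 < M%:R :> R by rewrite ltr0n.
rewrite (fejer_phase (- ((M%:R - 1) / 2 * p))).
under eq_bigr do rewrite -mulrBl.
set C := \sum_(j < M) _; set S := \sum_(j < M) _.
have CM : M%:R * (1 - (M%:R * p) ^+ 2 / 24) <= C.
  apply: (@le_trans _ _ (\sum_(j < M) (1 - (j%:R - (M%:R - 1) / 2) ^+ 2 * (p ^+ 2 / 2)))).
    rewrite sumrB -mulr_suml sum_centered_sqr sumr_const card_ord.
    by have := sqr_ge0 p; nra.
  apply: ler_sum => j _; apply: le_trans (cos_ge_quadratic _).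
  by rewrite exprMn mulrA.
rewrite ler_pdivlMr ?exprn_gt0 // mulrC -exprMn.
apply: (@le_trans _ _ (C ^+ 2)); last by rewrite lerDl sqr_ge0.
have h : 0 <= M%:R * (1 - (M%:R * p) ^+ 2 / 24) by apply: mulr_ge0; lra.
by rewrite lerXn2r ?nnegrE // (le_trans h).
Qed.

Lemma sin_pi_frac_gt0 d M : (0 < d < M)%N -> 0 < sin (pi * d%:R / M%:R) :> R.
Proof.
case/andP=> d0 dM; have M0 : 0 < M%:R :> R by rewrite ltr0n (leq_trans _ dM).
apply: sin_gt0_pi; apply/andP; split.
  by rewrite divr_gt0 // mulr_gt0 ?pi_gt0 // ltr0n.
by rewrite ltr_pdivrMr // ltr_pM2l ?pi_gt0 // ltr_nat.
Qed.

(** Over all M-th roots of unity the two ends of the telescoped sum differ by d full turns, while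
    [sin (p / 2)] is nonzero. *)
Lemma sum_cos_root d M q : (0 < d < M)%N ->
  \sum_(j < M) cos (j%:R * (2 * pi * d%:R / M%:R) + q) = 0 :> R.
Proof.
move=> dM; have M0 : M%:R != 0 :> R by rewrite pnatr_eq0; case: M dM; rewrite // andbF.
set p := 2 * pi * d%:R / M%:R.
have := dirichlet_cos M p q.
have -> : M%:R * p + q - p / 2 = q - p / 2 + pi *+ 2 *+ d.
  by rewrite -[_ *+ d]mulr_natl -[pi *+ 2]mulr_natl /p; field.
rewrite (periodicn (@sinD2pi R)) subrr => /eqP; rewrite mulf_eq0 => /orP[|/eqP//].
have -> : p / 2 = pi * d%:R / M%:R by rewrite /p; field.
by rewrite mulf_eq0 pnatr_eq0 /= gt_eqF // sin_pi_frac_gt0.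
Qed.

Lemma sum_sin_root d M q : (0 < d < M)%N ->
  \sum_(j < M) sin (j%:R * (2 * pi * d%:R / M%:R) + q) = 0 :> R.
Proof.
move=> dM; under eq_bigr do rewrite -cosBpihalf -addrA.
exact: sum_cos_root.
Qed.

Lemma fejer_root d M : (0 < d < M)%N -> fejer M (2 * pi * d%:R / M%:R) = 0.
Proof.
move=> dM; rewrite (fejer_phase 0) sum_cos_root // sum_sin_root //.
by rewrite expr0n addr0 mul0r.
Qed.

(** Parseval: expand the square as a double sum over [j], [k]; summing over [y] kills the terms with
    j != k and leaves M diagonal terms equal to M. *)
Lemma fejer_sum M a : (0 < M)%N ->
  \sum_(y < M) fejer M (a - 2 * pi * y%:R / M%:R) = 1.
Proof.
move=> M0; have M0' : M%:R != 0 :> R by rewrite pnatr_eq0 -lt0n.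
have gt_case (j k : 'I_M) : (k < j)%N ->
    \sum_(y < M) cos ((j%:R - k%:R) * (a - 2 * pi * y%:R / M%:R)) = 0 :> R.
  move=> kj; rewrite -natrB 1?ltnW //.
  rewrite -[RHS](@sum_cos_root (j - k) M (- ((j - k)%:R * a))); last first.
    by rewrite subn_gt0 kj (leq_ltn_trans (leq_subr _ _)).
  by apply: eq_bigr => y _; rewrite -cosN; congr cos; field.
have E p : fejer M p = (\sum_(j < M) \sum_(k < M) cos ((j%:R - k%:R) * p)) / M%:R ^+ 2.
  rewrite /fejer !expr2 !big_distrlr /= -big_split /=; congr (_ / _).
  apply: eq_bigr => j _; rewrite -big_split /=; apply: eq_bigr => k _.
  by rewrite mulrBl cosB.
under eq_bigr do rewrite E.
rewrite -mulr_suml exchange_big /=.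
rewrite (eq_bigr (fun=> M%:R)) => [|j _].
  by rewrite sumr_const card_ord -(mulr_natr M%:R) divff // mulf_neq0.
rewrite exchange_big /= (bigD1 j) //= [X in _ + X]big1 ?addr0 => [|k].
  under eq_bigr do rewrite subrr mul0r cos0.
  by rewrite sumr_const card_ord.
rewrite neq_ltn => /orP[/gt_case//|/gt_case H].
rewrite -[RHS]H; apply: eq_bigr => y _.
by rewrite -cosN -mulNr opprB.
Qed.

End FejerKernel.

(** * Complex exponentials and unitarity of the Fourier matrix *)

Section QuantumFourier.
Variable R : realType.
Implicit Types (x y : R) (M : nat).

Lemma rCM x y : rC (x * y) = rC x * rC y :> R[i].
Proof. exact: (rmorphM (real_complex R)). Qed.

Lemma rCV x : rC x^-1 = (rC x)^-1 :> R[i].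
Proof. exact: (fmorphV (real_complex R)). Qed.

Lemma rC_sum (I : Type) (r : seq I) (P : pred I) (F : I -> R) :
  rC (\sum_(i <- r | P i) F i) = \sum_(i <- r | P i) rC (F i) :> R[i].
Proof. exact: (rmorph_sum (real_complex R)). Qed.

Lemma sum_Complex (I : Type) (r : seq I) (P : pred I) (F G : I -> R) :
  \sum_(i <- r | P i) Complex (F i) (G i) =
  Complex (\sum_(i <- r | P i) F i) (\sum_(i <- r | P i) G i).
Proof. by elim/big_rec3: _ => // i a b c _ ->. Qed.

Lemma expi0 : expi 0 = 1 :> R[i].
Proof. by rewrite /expi cos0 sin0. Qed.

Lemma expiD x y : expi (x + y) = expi x * expi y.
Proof.
transitivity (Complex (cos x * cos y - sin x * sin y) (cos x * sin y + sin x * cos y)) => //.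
by rewrite /expi cosD sinD; congr Complex; ring.
Qed.

Lemma mul_expi_rC x y : expi x * rC y = Complex (cos x * y) (sin x * y).
Proof.
transitivity (Complex (cos x * y - sin x * 0) (cos x * 0 + sin x * y)) => //.
by congr Complex; ring.
Qed.

Lemma sqrt_natr_sqr M : Num.sqrt M%:R * Num.sqrt M%:R = M%:R :> R.
Proof. by rewrite -expr2 sqr_sqrtr. Qed.

(** Orthogonality of characters: an entry off the diagonal is a full sum over roots of unity with
    step |y - z|, the two orders of [y] and [z] being conjugate. *)
Lemma QFT_left_inverse M : (0 < M)%N -> QFT R M *m
  (\matrix_(y < M, x < M) (expi (- (2 * pi * (x * y)%:R / M%:R)) / rC (Num.sqrt M%:R))) = 1%:M.
Proof.
move=> M0; have M0' : M%:R != 0 :> R by rewrite pnatr_eq0 -lt0n.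
apply/matrixP => y z; rewrite !mxE.
have E (x : 'I_M) : QFT R M y x *
    (\matrix_(y < M, x < M) (expi (- (2 * pi * (x * y)%:R / M%:R)) / rC (Num.sqrt M%:R))) x z
    = Complex (cos (x%:R * (2 * pi * (y%:R - z%:R) / M%:R)))
              (sin (x%:R * (2 * pi * (y%:R - z%:R) / M%:R))) * rC M%:R^-1.
  rewrite !mxE mulrACA -expiD -!rCV -rCM -invfM sqrt_natr_sqr; congr (_ * _).
  have -> // : 2 * pi * (x * y)%:R / M%:R - 2 * pi * (z * x)%:R / M%:R =
      x%:R * (2 * pi * (y%:R - z%:R) / M%:R) :> R.
  by rewrite !natrM; field.
rewrite (eq_bigr _ (fun (x : 'I_M) _ => E x)) -mulr_suml sum_Complex.
have [->|] := eqVneq y z.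
  rewrite subrr; under eq_bigr do rewrite mulr0 mul0r mulr0 cos0.
  rewrite [X in Complex _ X]big1 => [|i _]; last by rewrite mulr0 mul0r mulr0 sin0.
  by rewrite sumr_const card_ord -/(rC _) -rCM divff.
have Z d : (0 < d < M)%N -> Complex (\sum_(j < M) cos (j%:R * (2 * pi * d%:R / M%:R)))
    (\sum_(j < M) sin (j%:R * (2 * pi * d%:R / M%:R))) = 0 :> R[i].
  move=> dM; have := sum_cos_root (0 : R) dM; under eq_bigr do rewrite addr0; move=> ->.
  by have := sum_sin_root (0 : R) dM; under eq_bigr do rewrite addr0; move=> ->.
rewrite neq_ltn => /orP[yz|zy].
- have e (x : 'I_M) : x%:R * (2 * pi * (y%:R - z%:R) / M%:R) =
    - (x%:R * (2 * pi * (z - y)%:R / M%:R)) :> R by rewrite natrB 1?ltnW //; field.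
  under eq_bigr do rewrite e cosN.
  under [X in Complex _ X]eq_bigr do rewrite e sinN.
  rewrite sumrN; have /Z [-> ->] : (0 < z - y < M)%N.
    by rewrite subn_gt0 yz (leq_ltn_trans (leq_subr _ _)).
  by rewrite oppr0 mul0r.
- under eq_bigr do rewrite -natrB 1?ltnW //.
  under [X in Complex _ X]eq_bigr do rewrite -natrB 1?ltnW //.
  by rewrite Z ?mul0r // subn_gt0 zy (leq_ltn_trans (leq_subr _ _)).
Qed.

Lemma invmx_QFT M : (0 < M)%N -> invmx (QFT R M) =
  \matrix_(y < M, x < M) (expi (- (2 * pi * (x * y)%:R / M%:R)) / rC (Num.sqrt M%:R)).
Proof.
move=> M0; have AB := QFT_left_inverse M0.
by rewrite -[RHS](mulKmx (proj1 (mulmx1_unit AB))) AB mulmx1.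
Qed.

Lemma QFT_unit M : (0 < M)%N -> QFT R M \in unitmx.
Proof. by move=> /QFT_left_inverse /mulmx1_unit []. Qed.

End QuantumFourier.

(** * Grover iterates and the outcome distribution of one counting call *)

Section CountingAmplitudes.
Variables (R : realType) (N : nat) (f : 'I_N -> bool).
Hypothesis N_gt0 : (0 < N)%N.
Local Notation rootN := (Num.sqrt (N%:R : R)).
Local Notation "0_N" := (Ordinal N_gt0).

Lemma rootN_neq0 : rootN != 0.
Proof. by rewrite sqrtr_eq0 -ltNge ltr0n. Qed.

Lemma QFT_col0 M (M0 : (0 < M)%N) (x : 'I_M) :
  QFT R M x (Ordinal M0) = rC (Num.sqrt M%:R)^-1.
Proof. by rewrite mxE /= mul0n mulr0 mul0r expi0 mul1r rCV. Qed.

Lemma invmx_QFT_row0 (x : 'I_N) : invmx (QFT R N) 0_N x = rC rootN^-1.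
Proof. by rewrite invmx_QFT // mxE /= muln0 mulr0 mul0r oppr0 expi0 mul1r rCV. Qed.

Lemma Aop_ket0 (x : 'I_N) : (Aop R N *m ket0 R N) x ord0 = rC rootN^-1.
Proof.
rewrite mxE (bigD1 0_N) //= big1 => [|z zN]; last first.
  by rewrite [ket0 _ _ _ _]mxE (negbTE zN : (z == 0 :> nat) = false) mulr0.
by rewrite [ket0 _ _ _ _]mxE /= mulr1 addr0 QFT_col0.
Qed.

(** [S0] is the identity minus twice the projector on |0>, and both column 0 of [Aop] and row 0 of
    its inverse are constantly 1/sqrt N. *)
Lemma inversion_about_mean (x y : 'I_N) :
  (Aop R N *m S0 R N *m invmx (Aop R N)) x y = (x == y)%:R - rC (2 / N%:R).
Proof.
have <- : (Aop R N *m invmx (Aop R N)) x y = (x == y)%:R.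
  by rewrite mulmxV ?QFT_unit // mxE.
have E (z : 'I_N) : (Aop R N *m S0 R N) x z =
    Aop R N x z * (if (z : nat) == 0%N then -1 else 1).
  rewrite mxE (bigD1 z) //= big1 => [|w wz]; last by rewrite [S0 _ _ _ _]mxE (negbTE wz) mulr0.
  by rewrite [S0 _ _ _ _]mxE eqxx addr0.
rewrite [LHS]mxE [in RHS]mxE (bigD1 0_N) //= [in RHS](bigD1 0_N) //= E /=.
rewrite (eq_bigr (fun z => Aop R N x z * invmx (Aop R N) z y)) => [|z zN]; last first.
  by rewrite E (negbTE zN : (z == 0 :> nat) = false) mulr1.
rewrite invmx_QFT_row0 QFT_col0 mulrN1 mulNr -rCM -invfM sqrt_natr_sqr.
have -> : rC (2 / N%:R) = rC N%:R^-1 + rC N%:R^-1 :> R[i].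
  transitivity (Complex (N%:R^-1 + N%:R^-1) (0 + 0) : R[i]) => //.
  by rewrite addr0 /rC; congr Complex; ring.
by ring.
Qed.

Lemma Qop_mul (v : 'cV[R[i]]_N) (x : 'I_N) : (Qop R f *m v) x ord0 =
  rC (2 / N%:R) * (\sum_y (-1) ^+ f y * v y ord0) - (-1) ^+ f x * v x ord0.
Proof.
rewrite /Qop mulNmx mxE -(mulmxA _ (Sf R f) v) mxE.
have E (y : 'I_N) : (Sf R f *m v) y ord0 = (-1) ^+ f y * v y ord0.
  rewrite mxE (bigD1 y) //= big1 => [|z zy]; last first.
    by rewrite [Sf _ _ _ _]mxE eq_sym (negbTE zy) mul0r.
  by rewrite [Sf _ _ _ _]mxE eqxx addr0.
under eq_bigr do rewrite inversion_about_mean E mulrBl.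
rewrite sumrB -mulr_sumr (bigD1 x) //= eqxx mul1r big1 ?addr0 ?opprB // => y.
by rewrite eq_sym => /negbTE ->; rewrite mul0r.
Qed.

Variable th : R.
Hypothesis sin2_th : N%:R * sin th ^+ 2 = (nsol f)%:R.

Lemma cos2_th : N%:R * cos th ^+ 2 = (N - nsol f)%:R.
Proof.
rewrite natrB; last by rewrite -[leqRHS](card_ord N) max_card.
by rewrite -sin2_th cos2sin2; ring.
Qed.

Lemma sum_by_f (a b : R) :
  \sum_(x < N) (if f x then a else b) = (nsol f)%:R * a + (N - nsol f)%:R * b.
Proof.
rewrite (bigID f) /=.
rewrite (eq_bigr (fun=> a)) => [|x ->//].
rewrite [X in _ + X](eq_bigr (fun=> b)) => [|x /negbTE ->//].
rewrite !sumr_const !mulr_natl /nsol cardsE; congr (_ *+ _ + _ *+ _).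
apply/eqP; rewrite -(eqn_add2l #|f|) subnKC; last first.
  by rewrite -[leqRHS](card_ord N) max_card.
by rewrite -[X in _ == X](card_ord N) -(cardC f).
Qed.

Lemma sin_th_neq0 (x : 'I_N) : f x -> sin th != 0.
Proof.
move=> fx; apply/eqP => s0; move/eqP: sin2_th.
rewrite s0 expr0n mulr0 eq_sym pnatr_eq0 cards_eq0 => /eqP/setP/(_ x).
by rewrite !inE fx.
Qed.

Lemma cos_th_neq0 (x : 'I_N) : ~~ f x -> cos th != 0.
Proof.
move=> fx; apply/eqP => s0; move/eqP: cos2_th.
rewrite s0 expr0n mulr0 eq_sym pnatr_eq0 subn_eq0 leqNgt => /negP; apply.
rewrite -[X in (_ < X)%N](card_ord N) /nsol cardsE.
by apply/proper_card/properP; split; [exact/subsetP|exists x].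
Qed.

(* Each branch occurs only when its denominator is nonzero: sin th = 0 forces
   f to be identically false, cos th = 0 identically true. *)
Definition grover_amp (j : nat) (x : 'I_N) : R :=
  if f x then sin ((2 * j%:R + 1) * th) / (rootN * sin th)
  else cos ((2 * j%:R + 1) * th) / (rootN * cos th).

(** Replacing the class sizes by N sin^2 th and N cos^2 th leaves cos cos - sin sin, which the
    addition formula collapses. *)
Lemma mean_grover_amp j :
  2 / N%:R * (\sum_y (-1) ^+ f y * grover_amp j y) = 2 / rootN * cos ((2 * j%:R + 2) * th).
Proof.
rewrite (eq_bigr (fun y => if f y then - (sin ((2 * j%:R + 1) * th) / (rootN * sin th))
  else cos ((2 * j%:R + 1) * th) / (rootN * cos th))) => [|y _]; last first.
  by rewrite /grover_amp; case: (f y); rewrite ?expr1 ?mulN1r ?expr0 ?mul1r.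
have N0 : N%:R != 0 :> R by rewrite pnatr_eq0 -lt0n.
rewrite sum_by_f -sin2_th -cos2_th.
have -> : (2 * j%:R + 2) * th = (2 * j%:R + 1) * th + th by ring.
have r0 := rootN_neq0; have Nr := sqrt_natr_sqr R N.
rewrite cosD; set S := sin (_ * _); set C := cos (_ * _).
move: (Num.sqrt _) r0 Nr => r r0 <-.
have -> : r * r * sin th ^+ 2 * - (S / (r * sin th)) = - (r * sin th * S).
  have [->|s0] := eqVneq (sin th) 0; first by rewrite expr0n !mulr0 !mul0r oppr0.
  by field; rewrite r0 s0.
have -> : r * r * cos th ^+ 2 * (C / (r * cos th)) = r * cos th * C.
  have [->|c0] := eqVneq (cos th) 0; first by rewrite expr0n !mulr0 !mul0r.
  by field; rewrite r0 c0.
by field.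
Qed.

Lemma grover_iter j : iter j (fun v : 'cV[R[i]]_N => Qop R f *m v) (Aop R N *m ket0 R N) =
  \col_x rC (grover_amp j x).
Proof.
have r0 := rootN_neq0.
elim: j => [|j IH].
  apply/matrixP => x k; rewrite ord1 Aop_ket0 mxE; congr rC.
  rewrite /grover_amp mulr0 add0r mul1r; case: ifPn => fx.
    by have s0 := sin_th_neq0 fx; field; rewrite r0 s0.
  by have s0 := cos_th_neq0 fx; field; rewrite r0 s0.
rewrite iterS IH; apply/matrixP => x k; rewrite ord1 Qop_mul !mxE.
have sg (b : bool) (a : R) : (-1) ^+ b * rC a = rC ((-1) ^+ b * a).
  by case: b; rewrite ?expr0 ?expr1 ?mul1r ?mulN1r //; exact/esym/(rmorphN (real_complex R)).
under eq_bigr do rewrite mxE sg.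
rewrite -rC_sum -rCM mean_grover_amp sg.
transitivity (rC (2 / rootN * cos ((2 * j%:R + 2) * th) - (-1) ^+ f x * grover_amp j x)).
  exact/esym/(rmorphB (real_complex R)).
congr rC; rewrite /grover_amp.
(* Old and new angles are th below and th above the angle (2 j + 2) th of the mean, so the
   sum-to-product identities finish both branches. *)
have -> : (2 * j.+1%:R + 1) * th = (2 * j%:R + 2) * th + th by rewrite -natr1; ring.
have -> : (2 * j%:R + 1) * th = (2 * j%:R + 2) * th - th by ring.
rewrite sinB cosB sinD cosD.
case: ifPn => fx; rewrite ?expr1 ?expr0.
  by have s0 := sin_th_neq0 fx; field; rewrite r0 s0.
by have s0 := cos_th_neq0 fx; field; rewrite r0 s0.
Qed.

(** The first Fourier transform makes row j equal to the j-th Grover iterate over sqrt M; the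
    inverse transform then takes the Fourier coefficient in j of real amplitudes. *)
Lemma count_final_stateE M (y : 'I_M) (x : 'I_N) :
  count_final_state R f M y x =
  Complex (\sum_(j < M) cos (j%:R * (2 * pi * y%:R / M%:R)) * grover_amp j x / M%:R)
    (- (\sum_(j < M) sin (j%:R * (2 * pi * y%:R / M%:R)) * grover_amp j x / M%:R)).
Proof.
have M0 : (0 < M)%N by case: y => y; case: M.
have M0' : M%:R != 0 :> R by rewrite pnatr_eq0 -lt0n.
rewrite -sumrN -sum_Complex mxE; apply: eq_bigr => j _.
rewrite invmx_QFT // mxE [LambdaQ _ _ _ _]mxE.
have -> : trmx (row j (QFT R M *m init_state R N M)) =
    rC (Num.sqrt M%:R)^-1 *: (Aop R N *m ket0 R N).
  apply/matrixP => z k; rewrite ord1 [LHS]mxE [LHS]mxE [LHS]mxE [RHS]mxE.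
  rewrite (bigD1 (Ordinal M0)) //= big1 => [|w wM]; last first.
    by rewrite [init_state _ _ _ _ _]mxE (negbTE wM : (w == 0 :> nat) = false) mulr0.
  by rewrite [init_state _ _ _ _ _]mxE /= addr0 QFT_col0.
have -> (c : R[i]) (v : 'cV[R[i]]_N) k : iter k (fun v : 'cV[R[i]]_N => Qop R f *m v) (c *: v) =
    c *: iter k (fun v : 'cV[R[i]]_N => Qop R f *m v) v.
  by elim: k => //= k ->; rewrite -scalemxAr.
rewrite grover_iter.
have -> : (rC (Num.sqrt M%:R)^-1 *: \col_x rC (grover_amp j x)) x ord0 =
    rC (Num.sqrt M%:R)^-1 * rC (grover_amp j x) by rewrite !mxE.
rewrite -rCV -(mulrA (expi _)) -!rCM mul_expi_rC cosN sinN.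
have -> : 2 * pi * (j * y)%:R / M%:R = j%:R * (2 * pi * y%:R / M%:R) :> R.
  by rewrite natrM; field.
have -> : (Num.sqrt M%:R)^-1 * ((Num.sqrt M%:R)^-1 * grover_amp j x) = grover_amp j x / M%:R.
  by rewrite mulrA -invfM sqrt_natr_sqr mulrC.
by congr Complex; ring.
Qed.

(** In the degenerate case the marked sums vanish along with the number of solutions, so
    [count_probE] needs no separate statement there. *)
Lemma sin_odd_mul0 j : sin th = 0 -> sin ((2 * j%:R + 1) * th) = 0.
Proof.
move=> s0; elim: j => [|j IH]; first by rewrite mulr0 add0r mul1r.
have -> : (2 * j.+1%:R + 1) * th = (2 * j%:R + 1) * th + th + th by rewrite -natr1; ring.
by rewrite sinD (sinD _ th) (cosD _ th) IH s0; ring.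
Qed.

Lemma cos_odd_mul0 j : cos th = 0 -> cos ((2 * j%:R + 1) * th) = 0.
Proof.
move=> c0; elim: j => [|j IH]; first by rewrite mulr0 add0r mul1r.
have -> : (2 * j.+1%:R + 1) * th = (2 * j%:R + 1) * th + th + th by rewrite -natr1; ring.
by rewrite cosD (cosD _ th) (sinD _ th) IH c0; ring.
Qed.

(** The rotation has eigenphases 2 th and - 2 th, which share the mass equally; in real form this is
    the parallelogram identity applied to the Fourier sums of the marked ([X1], [X2]) and unmarked
    ([Y1], [Y2]) amplitudes. *)
Lemma count_probE M (y : 'I_M) : count_prob R f y =
  (fejer M (2 * th - 2 * pi * y%:R / M%:R) + fejer M (2 * th + 2 * pi * y%:R / M%:R)) / 2.
Proof.
have M0 : (0 < M)%N by case: y => y; case: M.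
have M0' : M%:R != 0 :> R by rewrite pnatr_eq0 -lt0n.
have N0 : N%:R != 0 :> R by rewrite pnatr_eq0 -lt0n.
rewrite /count_prob; set eta := 2 * pi * y%:R / M%:R.
pose X1 := \sum_(j < M) cos (j%:R * eta) * sin ((2 * j%:R + 1) * th).
pose X2 := \sum_(j < M) sin (j%:R * eta) * sin ((2 * j%:R + 1) * th).
pose Y1 := \sum_(j < M) cos (j%:R * eta) * cos ((2 * j%:R + 1) * th).
pose Y2 := \sum_(j < M) sin (j%:R * eta) * cos ((2 * j%:R + 1) * th).
rewrite (eq_bigr (fun x => if f x then (X1 ^+ 2 + X2 ^+ 2) / (M%:R * (rootN * sin th)) ^+ 2
   else (Y1 ^+ 2 + Y2 ^+ 2) / (M%:R * (rootN * cos th)) ^+ 2)) => [|x _]; last first.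
  rewrite count_final_stateE /sqmod /= sqrrN /grover_amp -/eta.
  have E c (F G : 'I_M -> R) :
      \sum_(j < M) F j * (G j / c) / M%:R = (\sum_(j < M) F j * G j) / (M%:R * c).
    by rewrite mulr_suml; apply: eq_bigr => j _; rewrite invfM; ring.
  by case: (f x); rewrite !E !expr_div_n mulrDl.
rewrite sum_by_f -sin2_th -cos2_th !exprMn sqr_sqrtr ?ler0n //.
have Xs : N%:R * sin th ^+ 2 * ((X1 ^+ 2 + X2 ^+ 2) / (M%:R ^+ 2 * (N%:R * sin th ^+ 2)))
    = (X1 ^+ 2 + X2 ^+ 2) / M%:R ^+ 2.
  have [s0|s0] := eqVneq (sin th) 0; last by field; rewrite M0' N0 s0.
  rewrite /X1 /X2 !big1 => [|j _|j _]; rewrite ?sin_odd_mul0 ?mulr0 //.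
  by rewrite expr0n addr0 !mul0r mulr0.
have Ys : N%:R * cos th ^+ 2 * ((Y1 ^+ 2 + Y2 ^+ 2) / (M%:R ^+ 2 * (N%:R * cos th ^+ 2)))
    = (Y1 ^+ 2 + Y2 ^+ 2) / M%:R ^+ 2.
  have [s0|s0] := eqVneq (cos th) 0; last by field; rewrite M0' N0 s0.
  rewrite /Y1 /Y2 !big1 => [|j _|j _]; rewrite ?cos_odd_mul0 ?mulr0 //.
  by rewrite expr0n addr0 !mul0r mulr0.
(* The extra phase th turns 2 j th into the odd multiples (2 j + 1) th occurring in the
   amplitudes. *)
rewrite Xs Ys (fejer_phase th) (fejer_phase th M (_ + eta)).
have em (j : 'I_M) : j%:R * (2 * th - eta) + th = (2 * j%:R + 1) * th - j%:R * eta by ring.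
have ep (j : 'I_M) : j%:R * (2 * th + eta) + th = (2 * j%:R + 1) * th + j%:R * eta by ring.
have -> : \sum_(j < M) cos (j%:R * (2 * th - eta) + th) = Y1 + X2.
  by rewrite -big_split /=; apply: eq_bigr => j _; rewrite em cosB; ring.
have -> : \sum_(j < M) sin (j%:R * (2 * th - eta) + th) = X1 - Y2.
  by rewrite -sumrB /=; apply: eq_bigr => j _; rewrite em sinB; ring.
have -> : \sum_(j < M) cos (j%:R * (2 * th + eta) + th) = Y1 - X2.
  by rewrite -sumrB /=; apply: eq_bigr => j _; rewrite ep cosD; ring.
have -> : \sum_(j < M) sin (j%:R * (2 * th + eta) + th) = X1 + Y2.
  by rewrite -big_split /=; apply: eq_bigr => j _; rewrite ep sinD; ring.
by field.
Qed.

(* Outcomes [y] and [M - y] give the same estimate, so both halves of the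
   distribution may be folded onto the kernel centred at [+ M th / pi]. *)
Lemma count_expectE M (g : R -> R) :
  \sum_(y < M) count_prob R f y * g (count_out R N M y) =
  \sum_(y < M) fejer M (2 * th - 2 * pi * y%:R / M%:R) * g (count_out R N M y).
Proof.
case: M => [|M]; first by rewrite !big_ord0.
set F := fun y : 'I_M.+1 =>
  fejer M.+1 (2 * th - 2 * pi * y%:R / M.+1%:R) * g (count_out R N M.+1 y).
have sym : \sum_(y < M.+1)
      fejer M.+1 (2 * th + 2 * pi * y%:R / M.+1%:R) * g (count_out R N M.+1 y) =
    \sum_y F y.
  rewrite [RHS](reindex_inj (@oppr_inj 'I_M.+1)) /=; apply: eq_bigr => y _.
  have M0' : M.+1%:R != 0 :> R by rewrite pnatr_eq0.
  (* Negation modulo M sends 0 to 0 and not to M, so this outcome is treated apart. *)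
  have [y0|y0] := eqVneq (y : nat) 0%N.
    have -> : y = 0 by apply: val_inj.
    by rewrite oppr0 /F /= !mulr0 mul0r addr0 subr0.
  have yE : ((- y : 'I_M.+1) : nat)%:R = M.+1%:R - y%:R :> R.
    rewrite /= modn_small; first by rewrite natrB // ltnW.
    by rewrite ltn_subrL lt0n y0.
  rewrite /F /count_out yE; congr (_ * g _).
    by rewrite -[RHS]fejerD2pi; congr fejer; rewrite mulr2n; move: (M.+1%:R) M0' => m m0; field.
  congr (_ * _).
  have -> : pi * (M.+1%:R - y%:R) / M.+1%:R = - (pi * y%:R / M.+1%:R) + pi :> R.
    by move: (M.+1%:R) M0' => m m0; field.
  by rewrite sinDpi sinN opprK.
rewrite (eq_bigr (fun y => (F y + fejer M.+1 (2 * th + 2 * pi * y%:R / M.+1%:R) *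
    g (count_out R N M.+1 y)) / 2)) => [|y _]; last by rewrite count_probE /F; ring.
by rewrite -mulr_suml big_split /= sym; field.
Qed.

Lemma count_prob_sum M : (0 < M)%N -> \sum_(y < M) count_prob R f y = 1.
Proof.
move=> M0; have := count_expectE M (fun=> 1).
under eq_bigr do rewrite mulr1; move=> ->.
by under eq_bigr do rewrite mulr1; exact: fejer_sum.
Qed.

End CountingAmplitudes.

(** * Mass of the kernel at the two grid points around its centre *)

Section KernelMass.
Variable R : realType.

Lemma fejer_le1 M (p : R) : (0 < M)%N -> fejer M p <= 1.
Proof.
move=> M0; rewrite -(fejer_sum p M0) (bigD1 (Ordinal M0)) //= mulr0 mul0r subr0.
by rewrite lerDl sumr_ge0 // => y _; exact: fejer_ge0.
Qed.

(** With a = pi^2/6, [fejer_lower] gives mass (1 - a x^2)^2 at distance x. The worst case is d =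
    1/2, where 2 (1 - a/4)^2 > 68/100. *)
Lemma fejer_adjacent M (d : R) : (0 < M)%N -> 0 <= d <= 1 ->
  68 / 100 <= fejer M (2 * pi * d / M%:R) + fejer M (2 * pi * (1 - d) / M%:R).
Proof.
move=> M0; wlog dh : d / d <= 1 / 2.
  move=> H d01; have [/H->//|dh] := leP d (1 / 2).
  by rewrite addrC -{2}(subKr 1 d); apply: H; lra.
move=> /andP[d0 _]; have M0' : M%:R != 0 :> R by rewrite pnatr_eq0 -lt0n.
have E x : (M%:R * (2 * pi * x / M%:R)) ^+ 2 / 24 = pi ^+ 2 / 6 * x ^+ 2 :> R by field.
have [p3 p315] := (@pi_ge3 R, @pi_le315 R).
have [al au] : 15 / 10 <= pi ^+ 2 / 6 :> R /\ pi ^+ 2 / 6 <= 1654 / 1000 :> R by split; nra.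
have L x : pi ^+ 2 / 6 * x ^+ 2 <= 1 ->
    (1 - pi ^+ 2 / 6 * x ^+ 2) ^+ 2 <= fejer M (2 * pi * x / M%:R) :> R.
  by move=> h; rewrite -E; apply: fejer_lower => //; move: h; rewrite -E; lra.
move: L al au; set a : R := pi ^+ 2 / 6 => L al au.
have Ld : (1 - a * d ^+ 2) ^+ 2 <= fejer M (2 * pi * d / M%:R) by apply: L; nra.
have [/L Ld'|far] := leP (a * (1 - d) ^+ 2) 1.
  apply: le_trans (lerD Ld Ld').
  (* Around the midpoint only even powers of s survive, with nonnegative coefficients because a >=
     4/3. *)
  set s := 1 / 2 - d.
  have -> : (1 - a * d ^+ 2) ^+ 2 + (1 - a * (1 - d) ^+ 2) ^+ 2 =
    2 * (1 - a / 4) ^+ 2 + 2 * s ^+ 2 * (a * (a - 2 * (1 - a / 4)) + a ^+ 2 * s ^+ 2).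
    by rewrite /s; field.
  have : 0 <= a * (a - 2 * (1 - a / 4)) by apply: mulr_ge0; lra.
  have := sqr_ge0 s; have := sqr_ge0 a.
  have h1 : 68 / 100 <= 2 * (1 - a / 4) ^+ 2 by nra.
  move=> h2 h3 h4; rewrite -[leLHS]addr0; apply: lerD => //.
  by apply: mulr_ge0; [exact: mulr_ge0 | apply: addr_ge0 => //; exact: mulr_ge0].
(* The far point is out of range of the lower bound, but then the near one is so close that its mass
   alone suffices. *)
have d1 : d <= 23 / 100 by nra.
apply: le_trans (_ : (1 - a * d ^+ 2) ^+ 2 <= _); last first.
  by apply: le_trans Ld _; rewrite lerDl fejer_ge0.
have : a * d ^+ 2 <= 9 / 100 by nra.
by nra.
Qed.

End KernelMass.

(** * One round of the doubling loop and the final call *)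

Section Loop.
Variables (R : realType) (N : nat) (f : 'I_N -> bool) (eps : R) (rnd : R -> int) (th : R).
Hypothesis N_gt0 : (0 < N)%N.
Hypothesis sin2_th : N%:R * sin th ^+ 2 = (nsol f)%:R.
Hypothesis eps01 : 0 < eps <= 1.

Local Notation pow2 l := ((2 ^ l)%:R : R).
Local Notation final_size l := `|Num.ceil (20 * pi ^+ 2 / eps * pow2 l)|%N.

Let eps_gt0 : 0 < eps. Proof. by case/andP: eps01. Qed.
Let eps_le1 : eps <= 1. Proof. by case/andP: eps01. Qed.

Lemma count_out_eq0 M (y : 'I_M) : (count_out R N M y == 0) = (y == 0%N :> nat).
Proof.
rewrite /count_out mulf_eq0 pnatr_eq0 eqn0Ngt N_gt0 /= sqrf_eq0.
have [->|y0] := eqVneq (y : nat) 0%N; first by rewrite mulr0 mul0r sin0 eqxx.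
by rewrite gt_eqF // sin_pi_frac_gt0 // lt0n y0 ltn_ord.
Qed.

(** The estimate vanishes only at outcome 0, whose mass is the kernel at 2 th; all other outcomes
    lead to the same final phase. *)
Lemma loop_phaseS fuel l acc (G : int -> nat -> R) :
  let p := fejer (2 ^ l) (2 * th) in
  let F := final_phase f eps rnd l (acc + 2 ^ l) G in
  loop_phase f eps rnd fuel.+1 l acc G =
  if pow2 l < 2 * Num.sqrt N%:R
  then p * loop_phase f eps rnd fuel l.+1 (acc + 2 ^ l) G + (1 - p) * F else F.
Proof.
have m0 : (0 < 2 ^ l)%N by rewrite expn_gt0.
rewrite /=; case: ifP => _.
  under eq_bigr do rewrite andbT.
  set V := loop_phase _ _ _ _ _ _ _; set F := final_phase _ _ _ _ _ _.
  rewrite (count_expectE N_gt0 sin2_th _ (fun v => if v == 0 then V else F)).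
  have := fejer_sum (2 * th) m0.
  rewrite (bigD1 (Ordinal m0)) //= mulr0 mul0r subr0 => h.
  under eq_bigr do rewrite count_out_eq0.
  rewrite (bigD1 (Ordinal m0)) //= mulr0 mul0r subr0; congr (_ + _).
  rewrite -[X in X - _]h addrAC subrr add0r mulr_suml.
  by apply: eq_bigr => y y0; rewrite ifN.
under eq_bigr do rewrite andbF.
by rewrite -mulr_suml (count_prob_sum N_gt0 sin2_th) // mul1r.
Qed.

Lemma pow2_ge1 l : 1 <= pow2 l.
Proof. by rewrite ler1n expn_gt0. Qed.

Lemma pow2S l : pow2 l.+1 = 2 * pow2 l.
Proof. by rewrite expnS natrM. Qed.

Lemma final_size_bounds l : 20 * pi ^+ 2 / eps * pow2 l <= (final_size l)%:R :> R /\
  (final_size l)%:R <= 200 * (pow2 l / eps) :> R.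
Proof.
set z := 20 * pi ^+ 2 / eps * pow2 l.
have /andP[lo hi] := real_ceil_itv (num_real z).
have P1 : 1 <= pow2 l / eps by rewrite ler_pdivlMr // mul1r (le_trans eps_le1) ?pow2_ge1.
have zE : z = 20 * pi ^+ 2 * (pow2 l / eps) by rewrite /z; ring.
have p3 := @pi_ge3 R; have p315 := @pi_le315 R.
have z0 : 0 < z by rewrite zE mulr_gt0 //; nra.
have -> : (final_size l)%:R = (Num.ceil z)%:~R :> R.
  by rewrite natr_absz ger0_norm // -(ler_int R) (le_trans (ltW z0)).
split=> //; move: lo; rewrite intrD.
(* One unit of [pow2 l / eps], which is at least 1, is left to pay for the ceiling. *)
have : 20 * pi ^+ 2 <= 199 :> R by nra.
by rewrite zE; nra.
Qed.

Lemma final_size_ge20 l : (20 <= final_size l)%N.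
Proof.
rewrite -(ler_nat R); apply: le_trans (proj1 (final_size_bounds l)).
have : 1 <= pow2 l / eps by rewrite ler_pdivlMr // mul1r (le_trans eps_le1) ?pow2_ge1.
have p3 := @pi_ge3 R.
have -> : 20 * pi ^+ 2 / eps * pow2 l = 20 * pi ^+ 2 * (pow2 l / eps) by ring.
by nra.
Qed.

Lemma final_phaseE l acc G : final_phase f eps rnd l acc G =
  \sum_(y < final_size l) fejer (final_size l) (2 * th - 2 * pi * y%:R / (final_size l)%:R) *
    G (rnd (count_out R N (final_size l) y)) (acc + final_size l)%N.
Proof.
exact: (count_expectE N_gt0 sin2_th _ (fun v => G (rnd v) (acc + final_size l)%N)).
Qed.

Lemma final_phase_evals l acc :
  final_phase f eps rnd l acc (fun _ c => c%:R) = (acc + final_size l)%:R.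
Proof.
rewrite final_phaseE -mulr_suml fejer_sum ?mul1r //.
exact: leq_trans (final_size_ge20 l).
Qed.

Lemma final_phase_ge0 l acc (G : int -> nat -> R) : (forall o n, 0 <= G o n) ->
  0 <= final_phase f eps rnd l acc G.
Proof.
by move=> G0; rewrite final_phaseE sumr_ge0 // => y _; rewrite mulr_ge0 ?fejer_ge0.
Qed.

Lemma fejer_pow2_le1 l : fejer (2 ^ l) (2 * th) <= 1.
Proof. by rewrite fejer_le1 // expn_gt0. Qed.

(** With one unit of fuel left the size test already fails, so the value 0 of exhausted fuel is
    never reached. *)
Lemma fuel_suffices : 2 * Num.sqrt N%:R <= pow2 N.+2.
Proof.
have : Num.sqrt N%:R <= N%:R :> R.
  rewrite -[leRHS]ger0_norm // -sqrtr_sqr ler_wsqrtr //.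
  by rewrite expr2 -natrM ler_nat leq_pmulr.
have : N%:R <= pow2 N by rewrite ler_nat ltnW // ltn_expl.
by have := pow2_ge1 N; rewrite !pow2S; lra.
Qed.

(** * Lower bounds on the expectation of a nonnegative payoff *)

Section LowerBound.
Variables (G : int -> nat -> R) (q : R).
Hypothesis G_ge0 : forall o n, 0 <= G o n.
Hypothesis q_ge0 : 0 <= q.
Hypothesis th_ge0 : 0 <= th.
Hypothesis th_large : 1 <= th * Num.sqrt N%:R.
Hypothesis final_ge : forall l acc, 1 / 5 < pow2 l * th -> q <= final_phase f eps rnd l acc G.

(* With x = 2^l th, a round fails to continue with probability at most x^2 / 3;
   221/225 + x^2 / 9 bounds 1 - sum_(i >= 0) (2^i x)^2 / 3, the sum being over
   the rounds with 2^i x <= 1/5. *)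
Lemma loop_phase_ge fuel l acc : (l + fuel.+1 = N.+3)%N ->
  (1 / 5 < pow2 l * th -> q <= loop_phase f eps rnd fuel.+1 l acc G) /\
  (pow2 l * th <= 2 / 5 ->
    q * (221 / 225 + (pow2 l * th) ^+ 2 / 9) <= loop_phase f eps rnd fuel.+1 l acc G).
Proof.
elim: fuel l acc => [|fuel IH] l acc lf.
  have nlt : (pow2 l < 2 * Num.sqrt N%:R) = false.
    by move: lf; rewrite addn1 => -[->]; apply/negbTE; rewrite -leNgt fuel_suffices.
  rewrite loop_phaseS nlt; have x15 : 1 / 5 < pow2 l * th.
    move/negbT: nlt; rewrite -leNgt => h.
    have : 2 * Num.sqrt N%:R * th <= pow2 l * th by apply: ler_wpM2r.
    by have := th_large; nra.
  split => [_|x25]; first exact: final_ge.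
  apply: le_trans (final_ge _ x15).
  by rewrite -[leRHS]mulr1 ler_wpM2l //; nra.
have [] := IH l.+1 (acc + 2 ^ l)%N; first by rewrite addSn -addnS.
set V := loop_phase _ _ _ _ _ _ _; rewrite pow2S loop_phaseS -/V.
have F0 := @final_phase_ge0 l (acc + 2 ^ l) G G_ge0.
have := @final_ge l (acc + 2 ^ l)%N; move: F0.
set F := final_phase _ _ _ _ _ _; set x := pow2 l * th => F0 Fq.
rewrite -mulrA -/x => V1 V2.
have p0 := @fejer_ge0 R (2 ^ l) (2 * th); have p1 := fejer_pow2_le1 l.
have pl : x <= 1 / 5 -> 1 - x ^+ 2 / 3 <= fejer (2 ^ l) (2 * th).
  move=> x15; have x0 : 0 <= x by rewrite mulr_ge0.
  have e : (pow2 l * (2 * th)) ^+ 2 = 4 * x ^+ 2 by rewrite /x; ring.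
  by apply: le_trans (fejer_lower _ _); rewrite ?expn_gt0 // e; nra.
move: p0 p1 pl; set p := fejer _ _ => p0 p1 pl.
have big : 1 / 5 < x -> q <= if pow2 l < 2 * Num.sqrt N%:R then p * V + (1 - p) * F else F.
  move=> x15; have qF := Fq x15; have qV := V1 ltac:(lra).
  by case: ifP => // _; nra.
split=> // x25; have [x15|x15] := leP x (1 / 5); last first.
  (* The factor 221/225 + x^2/9 reaches exactly 1 at x = 2/5. *)
  apply: le_trans (big x15); rewrite -[leRHS]mulr1 ler_wpM2l //; nra.
rewrite ifT; last first.
  rewrite ltNge; apply/negP => h.
  have : 2 * Num.sqrt N%:R * th <= x by apply: ler_wpM2r.
  by have := th_large; nra.
have qV := V2 ltac:(lra).
have x0 : 0 <= x by rewrite mulr_ge0.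
have x2 : x ^+ 2 <= 1 / 25 by nra.
apply: (@le_trans _ _ (p * V)); last by rewrite lerDl mulr_ge0 // subr_ge0.
(* The new factor exceeds the old one by x^2 (4/675 - 4 x^2/27), nonnegative precisely because x^2
   <= 1/25. *)
apply: (@le_trans _ _ ((1 - x ^+ 2 / 3) * (q * (221 / 225 + (2 * x) ^+ 2 / 9)))).
  rewrite mulrCA ler_wpM2l //; have := sqr_ge0 x; nra.
apply: ler_pM => //; [lra | | exact: pl].
by rewrite mulr_ge0 // addr_ge0 ?divr_ge0 ?sqr_ge0.
Qed.

(** Serves twice: with the success indicator for the probability, and with the evaluation count for
    the lower bound on the cost. *)
Lemma approx_count_ge : 221 / 225 * q <= approx_count_expect f eps rnd G.
Proof.
have [big small] := @loop_phase_ge N.+1 1 0 (add1n _).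
rewrite /approx_count_expect; have [le25|gt25] := leP (pow2 1 * th) (2 / 5).
  apply: le_trans (small le25); rewrite mulrC ler_wpM2l // lerDl.
  by rewrite divr_ge0 ?sqr_ge0.
apply: le_trans (big _); first by rewrite ler_piMl //; lra.
by apply: lt_trans gt25; lra.
Qed.

End LowerBound.

(** * Upper bounds on the expected cost *)

Section UpperBound.
Hypothesis s_gt0 : 0 < sin th.
Local Notation s := (sin th).
Local Notation evals := (fun (_ : int) (c : nat) => c%:R : R).

(* As the continuation probability is at most 1/4, the constant D = 402 only has
   to absorb 1 + 200 * 3/4 + 2 D / 4. *)
Lemma loop_evals_le_late fuel l acc : 2 <= pow2 l * s ->
  loop_phase f eps rnd fuel l acc evals <= acc%:R + 402 * (pow2 l / eps).
Proof.
elim: fuel l acc => [|fuel IH] l acc ls.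
  by rewrite addr_ge0 // mulr_ge0 // divr_ge0 // ltW.
have := IH l.+1 (acc + 2 ^ l)%N.
set V := loop_phase _ _ _ _ _ _ _; rewrite pow2S loop_phaseS final_phase_evals -/V => {}IH.
have {}IH := IH ltac:(lra); move: IH; rewrite -(mulrA 2) !natrD.
have [_] := final_size_bounds l.
have : pow2 l <= pow2 l / eps.
  by rewrite ler_pdivlMr // ler_piMr.
have p0 := @fejer_ge0 R (2 ^ l) (2 * th).
have := @fejer_upper R (2 ^ l) (2 * th).
have -> : 2 * th / 2 = th by field.
set p := fejer _ _ in p0 *; move: (pow2 l / eps) => u pu.
have p1 : p <= 1 / 4.
  have : 4 <= (s * pow2 l) ^+ 2 by nra.
  by nra.
have := ler0n R (2 ^ l).
move: (pow2 l) ls pu p1 (final_size l)%:R (acc%:R) => P ls pu p1 Mf A P0 h1 h2.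
by case: ifP => _; nra.
Qed.

(** Before the late regime costs grow geometrically: the term - 2^l / eps acts as a potential, whose
    change at each doubling pays for the current round. *)
Lemma loop_evals_le fuel l acc : pow2 l * s <= 4 ->
  loop_phase f eps rnd fuel l acc evals <= acc%:R + (1612 / s - pow2 l) / eps.
Proof.
have sV (a b : R) : a * s <= b -> a <= b / s by rewrite ler_pdivlMr.
elim: fuel l acc => [|fuel IH] l acc ls.
  have := sV _ _ ls; have : 0 < s^-1 by rewrite invr_gt0.
  move=> h1 h2; rewrite addr_ge0 // divr_ge0 ?(ltW eps_gt0) //; lra.
have [late|early] := leP 2 (pow2 l * s).
  apply: le_trans (loop_evals_le_late _ _ late) _.
  (* Handing over at 2^l <= 4 / s needs (402 + 1) * 4 = 1612. *)
  rewrite lerD2l mulrA ler_pM2r ?invr_gt0 //.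
  by have := sV _ _ ls; lra.
have := IH l.+1 (acc + 2 ^ l)%N.
set V := loop_phase _ _ _ _ _ _ _; rewrite pow2S loop_phaseS final_phase_evals -/V => {}IH.
have {}IH := IH ltac:(lra); move: IH; rewrite !natrD.
have [_] := final_size_bounds l.
have : pow2 l <= pow2 l / eps.
  by rewrite ler_pdivlMr // ler_piMr.
have : pow2 l / eps <= 2 / s / eps by rewrite ler_pM2r ?invr_gt0 // sV // ltW.
have p0 := @fejer_ge0 R (2 ^ l) (2 * th); have p1 := fejer_pow2_le1 l.
have : 0 <= pow2 l / eps by rewrite divr_ge0 // ltW.
have -> : (1612 / s - 2 * pow2 l) / eps = 806 * (2 / s / eps) - 2 * (pow2 l / eps) by ring.
have -> : (1612 / s - pow2 l) / eps = 806 * (2 / s / eps) - pow2 l / eps by ring.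
move: (2 / s / eps) (pow2 l / eps) => w u; set p := fejer _ _ in p0 p1 *.
move: (pow2 l) (final_size l)%:R (acc%:R) => P Mf A u0 uw Pu Mu IH.
have hV : V <= A + (806 * w - u) by lra.
have hF : A + P + Mf <= A + (806 * w - u) by lra.
by case: ifP => // _; nra.
Qed.

End UpperBound.
End Loop.

(** * Accuracy and cost of the whole algorithm *)

Section ApproxCount.
Variables (R : realType) (N : nat) (f : 'I_N -> bool) (eps : R) (rnd : R -> int).
Hypothesis N_gt0 : (0 < N)%N.
Hypothesis eps01 : 0 < eps <= 1.
Hypothesis rndP : rounding rnd.

Local Notation pow2 l := ((2 ^ l)%:R : R).
Local Notation final_size l := `|Num.ceil (20 * pi ^+ 2 / eps * pow2 l)|%N.
Local Notation t := ((nsol f)%:R : R).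
Let eps_gt0 : 0 < eps. Proof. by case/andP: eps01. Qed.
Let eps_le1 : eps <= 1. Proof. by case/andP: eps01. Qed.

Lemma nsol_le : (nsol f <= N)%N.
Proof. by rewrite -[leqRHS](card_ord N) max_card. Qed.

Lemma angle_exists : exists2 th : R, 0 <= th <= pi / 2 & sin th = Num.sqrt (t / N%:R).
Proof.
set s := Num.sqrt _.
have s1 : s <= 1.
  by rewrite -sqrtr1 ler_wsqrtr // ler_pdivrMr ?ltr0n // mul1r ler_nat nsol_le.
have s0 : 0 <= s by apply: sqrtr_ge0.
have sI : -1 <= s <= 1 by rewrite s1 andbT (le_trans _ s0) // lerN10.
exists (asin s); last by rewrite asinK // in_itv.
rewrite asin_lepi2 // andbT leNgt; apply/negP => a0.
have : 0 < sin (- asin s).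
  apply: sin_gt0_pi; rewrite oppr_gt0 a0 /=.
  by have := asin_geNpi2 sI; have := @pi_gt0 R; lra.
by rewrite sinN asinK ?in_itv //; lra.
Qed.

Lemma round_success (t' : R) : `|t' - t| <= eps * t / 3 ->
  `|(rnd t')%:~R - t| <= eps * t.
Proof.
move=> h; have := rndP t'; move: (rnd t') => o ho.
have et0 : 0 <= eps * t by rewrite mulr_ge0 // ltW.
have tri : `|o%:~R - t| <= 2 / 3 + eps * t / 3.
  have -> : o%:~R - t = (o%:~R - t') + (t' - t) by ring.
  by apply: le_trans (ler_normD _ _) _; rewrite lerD.
(* If eps t < 1, the total error is below 2/3 + 1/3, and two integers at distance less than 1
   coincide. *)
have [|lt1] := leP 1 (eps * t); first by lra.
have : `|o - (nsol f)%:Z|%R < 1.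
  by rewrite -(ltr_int R) intr_norm rmorphB /=; lra.
move=> lt1'; have -> : o = (nsol f)%:Z by lia.
by rewrite subrr normr0.
Qed.

Variable th : R.
Hypothesis th_range : 0 <= th <= pi / 2.
Hypothesis sin_th : sin th = Num.sqrt (t / N%:R).

Lemma sin2_angle : N%:R * sin th ^+ 2 = t.
Proof.
have N0 : N%:R != 0 :> R by rewrite pnatr_eq0 -lt0n.
by rewrite sin_th sqr_sqrtr ?divr_ge0 //; field.
Qed.

(** * The case of at least one solution *)

Section Positive.
Hypothesis t_gt0 : (0 < nsol f)%N.

Lemma sin_angle_gt0 : 0 < sin th.
Proof. by rewrite sin_th sqrtr_gt0 divr_gt0 ?ltr0n. Qed.

Lemma angle_ge_sin : sin th <= th.
Proof. by apply: sin_le_id; case/andP: th_range. Qed.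

(** In fact sin th * sqrt N = sqrt t. Hence the size cutoff 2 sqrt N cannot stop the loop while 2^l
    th <= 1/5. *)
Lemma angle_large : 1 <= th * Num.sqrt N%:R.
Proof.
apply: le_trans (_ : 1 <= sin th * Num.sqrt N%:R) _; last first.
  by rewrite ler_wpM2r ?sqrtr_ge0 ?angle_ge_sin.
rewrite sin_th -sqrtrM ?divr_ge0 // divfK ?pnatr_eq0 -?lt0n //.
by rewrite -{1}sqrtr1 ler_wsqrtr // ler1n.
Qed.

(** 20 pi^2 / 5 = 4 pi^2 >= 12 pi; the grid spacing pi / M is thus at most eps th / 12. *)
Lemma final_size_angle l : 1 / 5 < pow2 l * th -> 12 * pi <= eps * th * (final_size l)%:R.
Proof.
move=> lth; have [lo _] := final_size_bounds eps01 l.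
have p3 := @pi_ge3 R.
apply: le_trans (_ : _ <= eps * th * (20 * pi ^+ 2 / eps * pow2 l)) _; last first.
  by rewrite ler_wpM2l // mulr_ge0 ?(ltW eps_gt0) //; case/andP: th_range.
have -> : eps * th * (20 * pi ^+ 2 / eps * pow2 l) = 20 * pi ^+ 2 * (pow2 l * th).
  by field; rewrite gt_eqF.
by have := sqr_ge0 (pi : R); nra.
Qed.

Lemma estimate_error M (y : nat) : 12 * pi <= eps * th * M%:R ->
  `|M%:R * th / pi - y%:R| <= 1 -> `|count_out R N M y - t| <= eps * t / 3.
Proof.
move=> hM near; have p3 := @pi_ge3 R; have p0 := @pi_gt0 R.
have /andP[th0 thp] := th_range.
have M0 : 0 < M%:R :> R.
  rewrite lt0r ler0n andbT; apply/eqP => e; move: hM; rewrite e mulr0; lra.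
have sth : 58 / 100 * th <= sin th by apply: sin_ge_linear.
have s0 := sin_angle_gt0.
set w : R := pi * y%:R / M%:R.
have close : `|w - th| <= eps * th / 12.
  have -> : w - th = - (pi / M%:R * (M%:R * th / pi - y%:R)).
    by rewrite /w; move: (pi : R) p0 => p p0; field; rewrite !gt_eqF.
  rewrite normrN normrM ger0_norm ?divr_ge0 ?pi_ge0 //.
  apply: le_trans (_ : pi / M%:R * 1 <= _); first by rewrite ler_wpM2l ?divr_ge0 ?pi_ge0.
  by rewrite mulr1 ler_pdivrMr //; lra.
(* The sine is 1-Lipschitz and th <= sin th / 0.58, and 1 / (12 * 0.58) < 0.15. *)
have dist : `|sin w - sin th| <= 15 / 100 * (eps * sin th).
  apply: le_trans (sin_dist _ _) _; apply: le_trans close _.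
  have : 0 <= eps * th by rewrite mulr_ge0 // ltW.
  by have : 58 / 100 * (eps * th) <= eps * sin th; [rewrite mulrCA ler_pM2l | lra].
have -> : count_out R N M y - t = N%:R * ((sin w - sin th) * ((sin w - sin th) + 2 * sin th)).
  by rewrite /count_out -/w -sin2_angle; ring.
rewrite -sin2_angle normrM ger0_norm //.
rewrite [leRHS](_ : _ = N%:R * (eps * sin th ^+ 2 / 3)); last by ring.
rewrite ler_wpM2l // normrM.
have h2 : `|sin w - sin th + 2 * sin th| <= 15 / 100 * (eps * sin th) + 2 * sin th.
  apply: le_trans (ler_normD _ _) _; rewrite lerD // ger0_norm //; lra.
apply: le_trans (ler_pM _ _ dist h2) _ => //.
(* As eps <= 1, the last factor is at most 0.15 * 2.15 < 1/3. *)
have -> : 15 / 100 * (eps * sin th) * (15 / 100 * (eps * sin th) + 2 * sin th) =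
  eps * sin th ^+ 2 * (15 / 100 * (15 / 100 * eps + 2)) by field.
by rewrite ler_wpM2l ?mulr_ge0 ?sqr_ge0 ?(ltW eps_gt0) //; have := eps_le1; lra.
Qed.

Lemma final_phase_success l acc : 1 / 5 < pow2 l * th ->
  68 / 100 <= final_phase f eps rnd l acc
    (fun o _ => if `|o%:~R - t| <= eps * t then 1 else 0).
Proof.
move=> lth; have hM := final_size_angle lth.
have M20 := final_size_ge20 eps01 l.
rewrite (final_phaseE eps rnd N_gt0 sin2_angle).
move: (final_size l) hM M20 => M hM M20.
have M0 : (0 < M)%N by apply: leq_trans M20.
have M0' : 0 < M%:R :> R by rewrite ltr0n.
have /andP[th0 thp] := th_range; have p0 := @pi_gt0 R.
set om := M%:R * th / pi.
have om0 : 0 <= om by rewrite divr_ge0 ?mulr_ge0 // ltW.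
(* As th <= pi/2, the centre lies in the first half of the grid, so both neighbours are genuine
   outcomes. *)
have omM : om <= M%:R / 2 by rewrite ler_pdivrMr // mulrAC -mulrA ler_wpM2l.
have /andP[y0 y1] := truncn_itv om0; set y := Num.truncn om in y0 y1.
have yM : (y.+1 < M)%N.
  rewrite -(ltr_nat R) -natr1; have : 20 <= M%:R :> R by rewrite ler_nat.
  by lra.
pose j0 := Ordinal (ltnW yM); pose j1 := Ordinal yM.
rewrite (bigD1 j0) //= (bigD1 j1) /=; last by rewrite -val_eqE /= neq_ltn ltnSn orbT.
rewrite -natr1 in y1.
have ok0 : `|count_out R N M y - t| <= eps * t / 3.
  by apply: estimate_error => //; rewrite -/om ler_norml; lra.
have ok1 : `|count_out R N M y.+1 - t| <= eps * t / 3.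
  by apply: estimate_error => //; rewrite -/om -natr1 ler_norml; lra.
rewrite !round_success // !mulr1.
have -> : 2 * th - 2 * pi * y%:R / M%:R = 2 * pi * (om - y%:R) / M%:R.
  by rewrite /om; move: (pi : R) p0 => p p0; field; rewrite !gt_eqF.
have -> : 2 * th - 2 * pi * y.+1%:R / M%:R = - (2 * pi * (1 - (om - y%:R)) / M%:R).
  by rewrite -natr1 /om; move: (pi : R) p0 => p p0; field; rewrite !gt_eqF.
rewrite fejerN; have := @fejer_adjacent R M (om - y%:R) M0 ltac:(lra).
move=> h; rewrite addrA; apply: le_trans h _; rewrite lerDl sumr_ge0 // => j _.
by rewrite mulr_ge0 ?fejer_ge0 //; case: ifP.
Qed.

Lemma success_pos : 2 / 3 <= success_prob f eps rnd.
Proof.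
have /andP[th0 _] := th_range.
apply: le_trans (_ : _ <= 221 / 225 * (68 / 100)) _; first by lra.
apply: (approx_count_ge N_gt0 sin2_angle _ _ th0 angle_large) => //.
- by move=> o n; case: ifP.
- by lra.
- exact: final_phase_success.
Qed.

Lemma sqrt_ratioE : Num.sqrt (N%:R / t) = (sin th)^-1.
Proof. by rewrite sin_th -sqrtrV ?divr_ge0 // invf_div. Qed.

Lemma evals_ge : 1 * (eps^-1 * Num.sqrt (N%:R / t)) <= expected_evals f eps rnd.
Proof.
have /andP[th0 thp] := th_range; have s0 := sin_angle_gt0.
rewrite sqrt_ratioE mul1r -invfM.
have u0 : 0 <= (eps * sin th)^-1 by rewrite invr_ge0 mulr_ge0 // ltW.
(* The 20 comes from M >= 12 pi / (eps th), th <= sin th / 0.58 and 12 * 3 * 0.58 > 20. *)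
apply: le_trans (_ : _ <= 221 / 225 * (20 * (eps * sin th)^-1)) _; first by lra.
apply: (approx_count_ge N_gt0 sin2_angle _ _ th0 angle_large) => //.
  by rewrite mulr_ge0.
move=> l acc lth; rewrite (final_phase_evals rnd N_gt0 sin2_angle) //.
have hM := final_size_angle lth.
apply: le_trans (_ : _ <= (final_size l)%:R) _; last by rewrite ler_nat leq_addl.
rewrite ler_pdivrMr ?mulr_gt0 //.
have sth : 58 / 100 * th <= sin th by apply: sin_ge_linear.
have p3 := @pi_ge3 R.
have : eps * th * (final_size l)%:R * (58 / 100) <= (final_size l)%:R * (eps * sin th).
  rewrite [leLHS](_ : _ = (final_size l)%:R * (eps * (58 / 100 * th))); last by ring.
  by rewrite ler_wpM2l // ler_wpM2l // ltW.
by lra.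
Qed.

Lemma evals_le : expected_evals f eps rnd <= 1612 * (eps^-1 * Num.sqrt (N%:R / t)).
Proof.
have s0 := sin_angle_gt0; have s1 := sin_le1 th.
apply: le_trans (@loop_evals_le R N f eps rnd th N_gt0 sin2_angle eps01 s0 N.+2 1 0 _) _.
  by lra.
rewrite add0r sqrt_ratioE mulrBl mulrA mulrAC lerBlDr lerDl.
by rewrite divr_ge0 ?ler0n // ltW.
Qed.

End Positive.

(** * The case without solutions *)

Section Zero.
Hypothesis t0 : nsol f = 0%N.

Lemma angle0 : th = 0.
Proof.
have : sin th = 0 by rewrite sin_th t0 mul0r sqrtr0.
have := sin_ge_linear th_range; case/andP: th_range => th0 _ h s0.
by apply/eqP; rewrite eq_le th0 andbT; lra.
Qed.

(** At th = 0 the other grid points are zeros of the kernel, and the only integer within 2/3 of the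
    estimate 0 is 0. *)
Lemma final_phase0 l acc G :
  final_phase f eps rnd l acc G = G 0 (acc + final_size l)%N.
Proof.
have M20 := final_size_ge20 eps01 l.
rewrite (final_phaseE eps rnd N_gt0 sin2_angle) angle0 mulr0.
move: (final_size l) M20 => M M20.
have M0 : (0 < M)%N by apply: leq_trans M20.
rewrite (bigD1 (Ordinal M0)) //= big1 => [|y y0]; last first.
  rewrite sub0r fejerN fejer_root ?mul0r // ltn_ord andbT lt0n.
  by apply: contraNneq y0 => y0; apply/eqP/val_inj.
rewrite mulr0 mul0r subr0 fejer0 // mul1r addr0; congr G.
rewrite /count_out mulr0 mul0r sin0 expr0n mulr0.
have := rndP 0; rewrite subr0; move: (rnd 0) => o h.
have : `|o| < 1 by rewrite -(ltr_int R) intr_norm; lra.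
by lia.
Qed.

(** Every round before the cutoff continues surely. The invariant acc <= 2^l holds as costs double,
    and 2^l <= 4 sqrt N since only values below 2 sqrt N are doubled. *)
Lemma loop_phase0 (Q : int -> nat -> bool) fuel l acc :
  (forall l acc, 2 * Num.sqrt N%:R <= pow2 l <= 4 * Num.sqrt N%:R ->
    (acc <= 2 ^ l)%N -> Q 0 (acc + 2 ^ l + final_size l)%N) ->
  (l + fuel.+1 = N.+3)%N -> (acc <= 2 ^ l)%N -> pow2 l <= 4 * Num.sqrt N%:R ->
  loop_phase f eps rnd fuel.+1 l acc (fun o c => if Q o c then 1 else 0) = 1.
Proof.
move=> QP; have stop l' acc' : 2 * Num.sqrt N%:R <= pow2 l' -> pow2 l' <= 4 * Num.sqrt N%:R ->
    (acc' <= 2 ^ l')%N ->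
    final_phase f eps rnd l' (acc' + 2 ^ l') (fun o c => if Q o c then 1 else 0) = 1.
  by move=> l2 l4 accl; rewrite final_phase0 QP // l2 l4.
elim: fuel l acc => [|fuel IH] l acc lf accl l4; rewrite (loop_phaseS eps rnd N_gt0 sin2_angle);
  rewrite angle0 (mulr0 2) fejer0 ?expn_gt0 // mul1r subrr mul0r addr0; case: ltP => hl.
- by move: lf hl; rewrite addn1 => -[->]; rewrite ltNge fuel_suffices.
- exact: stop.
- rewrite IH //.
  + by rewrite addSnnS.
  + by rewrite expnS mul2n -addnn leq_add2r.
  + by rewrite pow2S; lra.
- exact: stop.
Qed.

(** The loop costs at most 2 * 2^l <= 8 sqrt N, and the final call at most 200 * 4 sqrt N / eps; the
    last round alone gives the lower bound. *)
Lemma approx_count_zero (Q : int -> nat -> bool) :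
  (forall c, Num.sqrt (N%:R : R) <= c%:R <= (8 + 800 / eps) * Num.sqrt N%:R -> Q 0 c) ->
  approx_count_expect f eps rnd (fun o c => if Q o c then 1 else 0) = 1.
Proof.
move=> QP; apply: loop_phase0 => //; last first.
  have : 1 <= Num.sqrt N%:R :> R by rewrite -{1}sqrtr1 ler_wsqrtr // ler1n.
  by rewrite expn1; lra.
move=> l acc /andP[l2 l4] accl; apply: QP.
have [_ hi] := final_size_bounds eps01 l.
have : acc%:R <= pow2 l by rewrite ler_nat.
have : pow2 l / eps <= 4 * Num.sqrt N%:R / eps by rewrite ler_pM2r ?invr_gt0.
have -> : (8 + 800 / eps) * Num.sqrt N%:R =
    8 * Num.sqrt N%:R + 200 * (4 * Num.sqrt N%:R / eps) :> R by ring.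
rewrite !natrD; have := ler0n R acc; have := ler0n R (final_size l); have := sqrtr_ge0 (N%:R : R).
by lra.
Qed.

End Zero.
End ApproxCount.

Theorem theorem8 (R : realType) :
  (* success probability at least 2/3 *)
  (forall (N : nat) (f : 'I_N -> bool) (eps : R) (rnd : R -> int),
     (0 < N)%N -> 0 < eps <= 1 -> rounding rnd ->
     2 / 3 <= success_prob f eps rnd) /\
  (* t > 0 : expected number of evaluations in Theta((1/eps) sqrt(N/t)) *)
  (exists c1 c2 : R, 0 < c1 /\ 0 < c2 /\
     forall (N : nat) (f : 'I_N -> bool) (eps : R) (rnd : R -> int),
       0 < eps <= 1 -> rounding rnd -> (0 < nsol f)%N ->
       c1 * (eps^-1 * Num.sqrt (N%:R / (nsol f)%:R)) <= expected_evals f eps rnd /\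
       expected_evals f eps rnd <= c2 * (eps^-1 * Num.sqrt (N%:R / (nsol f)%:R))) /\
  (* t = 0 : output 0 with certainty, number of evaluations in Theta(sqrt N) *)
  (forall eps : R, 0 < eps <= 1 ->
     exists d1 d2 : R, 0 < d1 /\ 0 < d2 /\
       forall (N : nat) (f : 'I_N -> bool) (rnd : R -> int),
         (0 < N)%N -> rounding rnd -> nsol f = 0%N ->
         approx_count_expect f eps rnd
           (fun o c => if (o == 0) && (d1 * Num.sqrt N%:R <= c%:R <= d2 * Num.sqrt N%:R)
                       then 1 else 0) = 1).
Proof.
split; [|split].
- move=> N f eps rnd N_gt0 eps01 rndP.
  have [th th_range sin_th] := @angle_exists R N f N_gt0.
  have [t0|t_gt0] := posnP (nsol f); last exact: (success_pos N_gt0 eps01 rndP th_range sin_th).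
  rewrite /success_prob (approx_count_zero N_gt0 eps01 rndP th_range sin_th t0
    (Q := fun o _ => `|o%:~R - (nsol f)%:R| <= eps * (nsol f)%:R)) => [|c _]; first by lra.
  by rewrite t0 mulr0 subrr normr0.
- exists 1, 1612; split; [|split]; [lra | lra |].
  move=> N f eps rnd eps01 rndP t_gt0.
  have N_gt0 : (0 < N)%N by apply: leq_trans t_gt0 (nsol_le _).
  have [th th_range sin_th] := @angle_exists R N f N_gt0.
  split; first exact: (evals_ge rnd N_gt0 eps01 th_range sin_th t_gt0).
  exact: (evals_le rnd N_gt0 eps01 sin_th t_gt0).
- move=> eps eps01; have eps0 : 0 < eps by case/andP: eps01.
  exists 1, (8 + 800 / eps); split; [lra | split].
    by rewrite addr_gt0 // divr_gt0.
  move=> N f rnd N_gt0 rndP t0.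
  have [th th_range sin_th] := @angle_exists R N f N_gt0.
  apply: (approx_count_zero N_gt0 eps01 rndP th_range sin_th t0
    (Q := fun o c => (o == 0) && (1 * Num.sqrt N%:R <= c%:R <= (8 + 800 / eps) * Num.sqrt N%:R))).
  by move=> c; rewrite eqxx mul1r.
Qed.
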